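(* Fix a risk-aversion factor $\alpha\in(0,1]$, $\beta\in(0,1)$, $\rho\in[0,1)$ and a $2\times 2$ row-stochastic observation matrix $B$ that is TP2, i.e. $\det B\ge 0$. For a belief $\pi\in\Pi(2)$ let $$u^{H}(\pi)=1-\frac{\eta^{y=2}(1)}{\alpha},\qquad u^{L}(\pi)=1-\frac{\eta^{y=1}(1)}{\alpha}$$ denote two possible prices at $\pi$, where $\eta^{y}$ is the private belief obtained from $\pi$ and the observation $y$. Let $Q(\pi,u)$, $\pi\in\Pi(2)$, $u\in[0,1]$, and $V$ be the $Q$-function and value function of the controller's dynamic programming equation (see context), and write $$\mathbb{E}V(\pi)=(\mathbf 1'B_{y=1}\pi)\,V(\eta^{y=1})+(\mathbf 1'B_{y=2}\pi)\,V(\eta^{y=2}).$$ Then the $Q$-function simplifies as follows. (1) (Self-interested reward) $$Q(\pi,u)=\begin{cases}(u-\beta)+\rho V(\pi) & \text{if } u\in[0,u^{L}(\pi)],\\ (u-\beta)\,\mathbf 1'B_{y=2}\pi+\rho\,\mathbb{E}V(\pi) & \text{if } u\in(u^{L}(\pi),u^{H}(\pi)],\\ 0 & \text{otherwise,}\end{cases}$$ and $V(\pi)=\max_{u}Q(\pi,u)$, where $V(\pi)\ge 0$. (2) (Altruistic reward) $$Q(\pi,u)=\begin{cases}(u-\beta)+\rho\,\mathbb{E}V(\pi) & \text{if } u\in(u^{L}(\pi),u^{H}(\pi)],\\ 0 & \text{otherwise,}\end{cases}$$ and $V(\pi)=\max_{u}Q(\pi,u)$, where $V(\pi)\ge 0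$.
   Context: State, observations, actions: $x\in\{1,2\}$ (quality low/high, a random variable constant in time), private observation $y\in\{1,2\}$ with $B_{ij}=\mathbb P(y=j\mid x=i)$, action $a\in\{1,2\}$ (1: do not utilize the service, 2: utilize), price $u\in[0,1]$ chosen by the controller. $\Pi(2)=\{\pi\in\mathbb R^2:\pi(1)+\pi(2)=1,\ 0\le\pi(i)\le1\}$, $\mathbf 1=(1,1)'$, $B_{y}=\mathrm{diag}(B_{1y},B_{2y})$. Private belief: $\eta^{y}=B_y\pi/(\mathbf 1'B_y\pi)$. Sensor's action: the cost is $c(x,1)=0$ for both $x$, $c(1,2)=u$, $c(2,2)=u-1$. Given $\pi$, $u$ and $y$, the sensor picks $a\in\arg\min_{a}\mathrm{CVaR}_\alpha(c(x,a))$, where $\mathrm{CVaR}_\alpha(c(x,a))=\min_{z\in\mathbb R}\{z+\frac1\alpha\mathbb E[\max\{c(x,a)-z,0\}]\}$ and the expectation is with respect to $x\sim\eta^{y}$. Ties are resolved so that $a=2$ exactly when $u\le 1-\eta^{y}(1)/\alpha$. Denote the chosen action by $a(\pi,u,y)$. Public belief update (social learning filter): $T^{\pi}(\pi,a)=R_a^{\pi}\pi/(\mathbf 1'R_a^{\pi}\pi)$ and $\sigma(\pi,a)=\mathbf 1'R_a^{\pi}\pi$, where $R_a^{\pi}=\mathrm{diag}(\mathbb P(a\mid x=i,\pi),\,i=1,2)$ and $\mathbb P(a\mid x=i,\pi)=\sum_{y}\mathcal I(a=a(\pi,u,y))\,B_{iy}$, with $\mathcal I$ the indicator function. Instantaneous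 reward of the controller ($\beta$ is a fixed cost of service): self-interested, $(u-\beta)\mathcal I(a=2\mid\pi)$, which is evaluated as $r_u=\sum_{j}\sum_{i}(u-\beta)\,\mathcal I\big(u\le 1-\eta^{y=j}(1)/\alpha\big)B_{ij}\pi(i)$; altruistic, $(u-\beta)\mathcal I(a=y\mid\pi)$, which is evaluated as $r_u=(u-\beta)\,\mathcal I\big(u^L(\pi)<u\le u^H(\pi)\big)$. Dynamic programming equation, with discount factor $\rho$: $Q(\pi,u)=r_u+\rho\sum_{a\in\{1,2\}}V(T^\pi(\pi,a))\,\sigma(\pi,a)$ and $V(\pi)=\max_{u\in[0,1]}Q(\pi,u)$.
   Formalization: On the ''otherwise'' branch the DP equation gives Q = ρV(π), not 0; this is what is proved, with V(π) = max of the displayed piecewise function and the same optimal prices. An observation of probability 0 leaves the belief unchanged. *)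

(* Defs.v *)
From HB Require Import structures.
From mathcomp Require Import all_boot all_order all_algebra.
From mathcomp Require Import classical_sets boolp set_interval reals.
Set Implicit Arguments.
Unset Strict Implicit.
Unset Printing Implicit Defensive.
Import Order.TTheory GRing.Theory Num.Theory.
Local Open Scope classical_set_scope.
Local Open Scope ring_scope.

(* States, observations and actions all range over {1, 2}, encoded by 'I_2. *)
Definition one : 'I_2 := ord0.
Definition two : 'I_2 := ord_max.

Definition row_stochastic (R : realType) (B : 'M[R]_2) : Prop :=
  (forall i j, 0 <= B i j) /\ (forall i, \sum_j B i j = 1).

(* Pi(2) *)
Definition belief (R : realType) (pi : 'cV[R]_2) : Prop :=
  (forall i, 0 <= pi i 0 <= 1) /\ pi one 0 + pi two 0 = 1.

(* 1' v *)
Definition mass (R : realType) (v : 'cV[R]_2) : R := \sum_i v i 0.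

Definition obs_mx (R : realType) (B : 'M[R]_2) (y : 'I_2) : 'M[R]_2 :=
  diag_mx (\row_i B i y).

Definition obs_prob (R : realType) (B : 'M[R]_2) (pi : 'cV[R]_2) (y : 'I_2) : R :=
  mass (obs_mx B y *m pi).

(* Bayes' rule.  It is undefined when y has probability 0 under pi; by
   convention such a y leaves the belief unchanged. *)
Definition private_belief (R : realType) (B : 'M[R]_2) (pi : 'cV[R]_2)
    (y : 'I_2) : 'cV[R]_2 :=
  if obs_prob B pi y == 0 then pi
  else (obs_prob B pi y)^-1 *: (obs_mx B y *m pi).

Definition cost (R : realType) (u : R) (x a : 'I_2) : R :=
  if a == one then 0 else if x == one then u else u - 1.

(* CVaR at level alpha of a cost f : state -> R when the state has law eta.
   For 0 < alpha <= 1 the infimum over z is attained. *)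
Definition cvar (R : realType) (alpha : R) (eta : 'cV[R]_2) (f : 'I_2 -> R) : R :=
  inf [set z + alpha^-1 * (\sum_i eta i 0 * Num.max (f i - z) 0) | z in [set: R]].

Definition threshold (R : realType) (alpha : R) (B : 'M[R]_2) (pi : 'cV[R]_2)
    (y : 'I_2) : R :=
  1 - private_belief B pi y one 0 / alpha.

Definition uL (R : realType) (alpha : R) (B : 'M[R]_2) (pi : 'cV[R]_2) : R :=
  threshold alpha B pi one.
Definition uH (R : realType) (alpha : R) (B : 'M[R]_2) (pi : 'cV[R]_2) : R :=
  threshold alpha B pi two.

(* The sensor minimises CVaR; the threshold is used only to break ties. *)
Definition sensor_action (R : realType) (alpha : R) (B : 'M[R]_2)
    (pi : 'cV[R]_2) (u : R) (y : 'I_2) : 'I_2 :=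
  let risk a := cvar alpha (private_belief B pi y) (fun x => cost u x a) in
  if risk one < risk two then one
  else if risk two < risk one then two
  else if u <= threshold alpha B pi y then two else one.

(* R_a^pi *)
Definition action_mx (R : realType) (alpha : R) (B : 'M[R]_2)
    (pi : 'cV[R]_2) (u : R) (a : 'I_2) : 'M[R]_2 :=
  diag_mx (\row_i \sum_y (a == sensor_action alpha B pi u y)%:R * B i y).

(* sigma(pi, a) *)
Definition action_prob (R : realType) (alpha : R) (B : 'M[R]_2)
    (pi : 'cV[R]_2) (u : R) (a : 'I_2) : R :=
  mass (action_mx alpha B pi u a *m pi).

(* T^pi(pi, a).  The value when the action has probability 0 is irrelevant: it
   is always weighted by action_prob. *)
Definition public_update (R : realType) (alpha : R) (B : 'M[R]_2)
    (pi : 'cV[R]_2) (u : R) (a : 'I_2) : 'cV[R]_2 :=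
  (action_prob alpha B pi u a)^-1 *: (action_mx alpha B pi u a *m pi).

Definition reward_self (R : realType) (alpha beta : R) (B : 'M[R]_2)
    (pi : 'cV[R]_2) (u : R) : R :=
  \sum_j \sum_i
    (u - beta) * (u <= 1 - private_belief B pi j one 0 / alpha)%R%:R * B i j * pi i 0.

Definition reward_altr (R : realType) (alpha beta : R) (B : 'M[R]_2)
    (pi : 'cV[R]_2) (u : R) : R :=
  (u - beta) * (uL alpha B pi < u <= uH alpha B pi)%R%:R.

Definition Qfun (R : realType) (alpha rho : R) (B : 'M[R]_2)
    (r : 'cV[R]_2 -> R -> R) (V : 'cV[R]_2 -> R) (pi : 'cV[R]_2) (u : R) : R :=
  r pi u + rho * \sum_a V (public_update alpha B pi u a) * action_prob alpha B pi u a.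

(* v = max_(u in [0, 1]) q u, the maximum being attained *)
Definition is_max_price (R : realType) (q : R -> R) (v : R) : Prop :=
  (q @` `[0, 1]) v /\ ubound (q @` `[0, 1]) v.

(* V is the bounded solution on Pi(2) of the dynamic programming equation with
   instantaneous reward r; boundedness is what singles out the value function
   of the discounted problem among the solutions. *)
Definition value_function (R : realType) (alpha rho : R) (B : 'M[R]_2)
    (r : 'cV[R]_2 -> R -> R) (V : 'cV[R]_2 -> R) : Prop :=
  (exists M : R, forall pi, belief pi -> `|V pi| <= M) /\
  (forall pi, belief pi -> is_max_price (Qfun alpha rho B r V pi) (V pi)).

Definition EV (R : realType) (B : 'M[R]_2) (V : 'cV[R]_2 -> R) (pi : 'cV[R]_2) : R :=
  obs_prob B pi one * V (private_belief B pi one) +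
  obs_prob B pi two * V (private_belief B pi two).

Definition Qsimp_self (R : realType) (alpha beta rho : R) (B : 'M[R]_2)
    (V : 'cV[R]_2 -> R) (pi : 'cV[R]_2) (u : R) : R :=
  if u <= uL alpha B pi then (u - beta) + rho * V pi
  else if uL alpha B pi < u <= uH alpha B pi then
    (u - beta) * obs_prob B pi two + rho * EV B V pi
  else 0.

Definition Qsimp_altr (R : realType) (alpha beta rho : R) (B : 'M[R]_2)
    (V : 'cV[R]_2 -> R) (pi : 'cV[R]_2) (u : R) : R :=
  if uL alpha B pi < u <= uH alpha B pi then (u - beta) + rho * EV B V pi
  else 0.

(* Main.v *)
(* Comparing CVaR risks shows that the sensor uses the service exactly when
   the price is at most threshold y, and TP2 gives uL <= uH.  So for u <= uL or
   u > uH the action does not depend on y and the public belief stays at pi,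
   while for uL < u <= uH the action reveals y and the public belief becomes the
   private one.  At the price 1 the reward is nonnegative, hence V is bounded
   below by rho times any lower bound of V; being bounded, V is nonnegative.  Off
   the regions where Qs is nontrivial Q = rho V, and V = rho V iff V = 0, so the
   value 0 may be used there instead. *)
Require Import Defs.
From HB Require Import structures.
From mathcomp Require Import all_boot all_order all_algebra.
From mathcomp Require Import ring lra.
From mathcomp Require Import classical_sets boolp set_interval reals.
Set Implicit Arguments.
Unset Strict Implicit.
Unset Printing Implicit Defensive.
Import Order.TTheory GRing.Theory Num.Theory.
Local Open Scope classical_set_scope.
Local Open Scope ring_scope.

(* Importing BiPointed after Defs hides these two names. *)
Local Notation one := Defs.one.
Local Notation two := Defs.two.

(** * The two states and CVaR in closed form *)

Lemma sum_states (V : nmodType) (F : 'I_2 -> V) :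
  \sum_i F i = F one + F two.
Proof.
rewrite big_ord_recr big_ord_recr big_ord0 /= add0r.
by congr (F _ + F _); apply: val_inj.
Qed.

Lemma state_eqP (i : 'I_2) : {i = one} + {i = two}.
Proof. by case: i => [[|[|//]] ?]; [left|right]; apply: val_inj. Qed.

Section SocialLearning.
Variables (R : realType) (alpha : R) (B : 'M[R]_2).
Hypothesis halpha : 0 < alpha <= 1.
Hypothesis hB : row_stochastic B.
Implicit Types (pi eta : 'cV[R]_2) (u beta rho : R) (y a : 'I_2).

(** The objective is convex and piecewise linear in z with kinks at the two costs, so a kink is
    optimal. State [one], the costlier, gets its probability inflated by 1/alpha and capped at 1. *)
Lemma cvarE eta (f : 'I_2 -> R) : belief eta -> f two <= f one ->
  cvar alpha eta f =
  f two + Num.min 1 (eta one 0 / alpha) * (f one - f two).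
Proof.
move=> [he eta1] f21; have /andP[h0 h1] := he one.
have -> : cvar alpha eta f = inf [set z + alpha^-1 *
    (eta one 0 * Num.max (f one - z) 0 + eta two 0 * Num.max (f two - z) 0)
    | z in [set: R]].
  by congr inf; apply: eq_imagel => z _; rewrite sum_states.
have -> : eta two 0 = 1 - eta one 0 by rewrite -eta1 addrC addKr.
move: (eta one 0) h0 h1 => h h0 h1 {he eta1}.
case/andP: halpha => alpha_gt0 alpha_le1.
have k1 : 1 <= alpha^-1 by rewrite invf_ge1.
move: (alpha^-1) k1 => k k1.
set S := image _ _; set v := (X in _ = X).
have Sv : S v.
  rewrite /S /v; case: (leP 1 (h * k)) => hk; [exists (f one)|exists (f two)] => //.
    rewrite subrr maxxx (max_idPr _) ?subr_le0 //; ring.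
  by rewrite subrr maxxx (max_idPl _) ?subr_ge0 //; ring.
have lbv : lbound S v.
  move=> _ [z _ <-]; rewrite /v.
  have M1 : f one - z <= Num.max (f one - z) 0 by rewrite le_max lexx.
  have M2 : f two - z <= Num.max (f two - z) 0 by rewrite le_max lexx.
  have M10 : 0 <= Num.max (f one - z) 0 by rewrite le_max lexx orbT.
  have M20 : 0 <= Num.max (f two - z) 0 by rewrite le_max lexx orbT.
  move: (Num.max _ 0) (Num.max (f two - z) 0) M1 M2 M10 M20 => m1 m2 M1 M2 M10 M20.
  (* Dual certificate: [(w, 1 - w)] is a probability vector dominated by eta/alpha. Its mean cost is
     [v], and domination makes it a lower bound of the objective at every z. *)
  have : exists2 w, Num.min 1 (h * k) = w & [/\ 0 <= w <= 1, w <= h * k & 1 - w <= k * (1 - h)].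
    eexists; first by [].
    by case: (leP 1 (h * k)) => hk; split; nra.
  case=> w -> [/andP[w0 w1] wk wk'].
  have e1 : w * (f one - z) <= h * k * m1 by nra.
  have e2 : (1 - w) * (f two - z) <= k * (1 - h) * m2 by nra.
  lra.
by apply/le_anti/andP; split; [apply: ge_inf; first by exists v
  | apply: lb_le_inf; first by exists v].
Qed.

(** * Private beliefs and the sensor's threshold *)

Lemma mass_diag_mx (d : 'rV[R]_2) pi :
  mass (diag_mx d *m pi) = d 0 one * pi one 0 + d 0 two * pi two 0.
Proof. by rewrite /mass sum_states mul_diag_mx !mxE. Qed.

Lemma obs_probE pi y :
  obs_prob B pi y = B one y * pi one 0 + B two y * pi two 0.
Proof. by rewrite /obs_prob mass_diag_mx !mxE. Qed.

Lemma row_sum i : B i one + B i two = 1.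
Proof. by have [_ /(_ i)] := hB; rewrite sum_states. Qed.

Lemma obs_prob_ge0 pi y : belief pi -> 0 <= obs_prob B pi y.
Proof.
case: hB => B0 _ [hpi _]; rewrite obs_probE addr_ge0 // mulr_ge0 //.
  by case/andP: (hpi one).
by case/andP: (hpi two).
Qed.

Lemma obs_prob_sum pi : belief pi -> obs_prob B pi one + obs_prob B pi two = 1.
Proof.
move=> [_ <-]; have := row_sum one; have := row_sum two.
rewrite !obs_probE => /(canRL (addKr _)) -> /(canRL (addKr _)) ->; ring.
Qed.

Lemma belief_private pi y : belief pi -> belief (private_belief B pi y).
Proof.
move=> bpi; rewrite /private_belief; case: eqP => // /eqP s0.
have s_gt0 : 0 < obs_prob B pi y by rewrite lt_neqAle eq_sym s0 obs_prob_ge0.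
have [hpi _] := bpi; have [B0 _] := hB.
have w0 i : 0 <= B i y * pi i 0 by rewrite mulr_ge0 //; case/andP: (hpi i).
split.
  move=> i; rewrite /obs_mx mul_diag_mx !mxE mulrC divr_ge0 ?(ltW s_gt0) //=.
  rewrite ler_pdivrMr // mul1r obs_probE.
  by case: (state_eqP i) => ->; rewrite ?lerDl ?lerDr.
rewrite /obs_mx mul_diag_mx !mxE -mulrDr -obs_probE mulVf //.
Qed.

(** With t = eta(1)/alpha the risks are 0 and u - 1 + min(1, t). For t < 1 this compares u with 1 -
    t. For t >= 1 the second risk is u, and [0 <= u] makes this agree with a threshold 1 - t <= 0; a
    tie at u = 0 is settled by the threshold itself. *)
Lemma sensor_actionE pi u y : belief pi -> 0 <= u ->
  sensor_action alpha B pi u y =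
  if u <= threshold alpha B pi y then two else one.
Proof.
move=> bpi u0; rewrite /sensor_action !cvarE //; try exact: belief_private.
  rewrite /cost /= /threshold.
  move: (_ / alpha) => t.
  rewrite subrr mulr0 addr0 (_ : u - (u - 1) = 1); last by ring.
  rewrite mulr1.
  case: (leP 1 t) => ht; case: (ltP 0) => h1; case: ltP => h2 //;
    case: (leP u (1 - t)) => h3 //; exfalso; lra.
by rewrite /cost /=; lra.
Qed.

(** * TP2 and the order of the thresholds *)

Lemma det_obs : \det B = B one one * B two two - B one two * B two one.
Proof.
have e0 : lift one (0 : 'I_1) = two by apply: val_inj.
have e1 : lift two (0 : 'I_1) = one by apply: val_inj.
rewrite (expand_det_row _ one) sum_states /cofactor !det_mx11 !mxE !e0 !e1 /=; ring.
Qed.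

Lemma uL_le_uH pi : 0 <= \det B -> belief pi -> uL alpha B pi <= uH alpha B pi.
Proof.
move=> hdet bpi; rewrite /uL /uH /threshold lerD2l lerN2.
case/andP: halpha => alpha_gt0 _; rewrite ler_pM2r ?invr_gt0 //.
have s1 := obs_prob_ge0 one bpi; have s2 := obs_prob_ge0 two bpi.
have s12 := obs_prob_sum bpi.
have [hpi p1] := bpi; have /andP[p0 _] := hpi one; have /andP[q0 _] := hpi two.
have [B0 _] := hB; rewrite det_obs in hdet.
have r1 := row_sum one; have b11 := B0 one one; have b12 := B0 one two.
have b21 := B0 two one; have b22 := B0 two two.
have pq0 := mulr_ge0 p0 q0.
have pB11 := mulr_ge0 b11 p0.
have qB21 := mulr_ge0 b21 q0.
(* Cross-multiplying the two Bayes quotients leaves exactly this inequality. *)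
have dpq := mulr_ge0 hdet pq0.
rewrite /private_belief /obs_mx.
(* An observation of probability 0 keeps the belief at [pi]; the other then has probability 1 and
   keeps it too. *)
case: eqP => [e2|/eqP n2]; case: eqP => [e1|/eqP n1] //.
- rewrite mul_diag_mx !mxE; move: s12; rewrite e2 addr0 => s12.
  rewrite s12 invr1 mul1r; move: e2; rewrite obs_probE; nra.
- rewrite mul_diag_mx !mxE; move: s12; rewrite e1 add0r => s12.
  rewrite s12 invr1 mul1r; move: e1; rewrite obs_probE; nra.
rewrite !mul_diag_mx !mxE ![_^-1 * _]mulrC ler_pdivrMr; last by rewrite lt_neqAle eq_sym n2.
rewrite mulrAC ler_pdivlMr; last by rewrite lt_neqAle eq_sym n1.
by rewrite !obs_probE; nra.
Qed.

(** * The public belief after the sensor's action *)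

Definition continuation (V : 'cV[R]_2 -> R) pi u : R :=
  \sum_a V (public_update alpha B pi u a) * action_prob alpha B pi u a.

(** Rows of [B] sum to 1, so the common action has likelihood 1 in both states and Bayes' rule
    returns the prior; the other action has weight 0. *)
Lemma continuation_pooling V pi u a : belief pi ->
  (forall y, sensor_action alpha B pi u y = a) -> continuation V pi u = V pi.
Proof.
move=> bpi ha.
have mxE' b : action_mx alpha B pi u b = (b == a)%:R%:M.
  rewrite /action_mx -diag_const_mx; congr diag_mx; apply/rowP => i; rewrite !mxE.
  by rewrite sum_states !ha -mulrDr row_sum mulr1.
have prE b : action_prob alpha B pi u b = (b == a)%:R.
  rewrite /action_prob mxE' mul_scalar_mx /mass sum_states !mxE -mulrDr.
  by case: bpi => _ ->; rewrite mulr1.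
rewrite /continuation (bigD1 a) //= big1 ?addr0 => [|b /negPf nb].
  by rewrite /public_update prE mxE' eqxx invr1 scale1r mul1mx mulr1.
by rewrite prE nb mulr0.
Qed.

Lemma continuation_separating V pi u :
  (forall y, sensor_action alpha B pi u y = y) ->
  continuation V pi u = EV B V pi.
Proof.
move=> ha.
have mxE' a : action_mx alpha B pi u a = obs_mx B a.
  congr diag_mx; apply/rowP => i; rewrite !mxE (bigD1 a) //= big1 ?addr0.
    by rewrite ha eqxx mul1r.
  by move=> y /negPf ya; rewrite ha eq_sym ya mul0r.
have prE a : action_prob alpha B pi u a = obs_prob B pi a.
  by rewrite /action_prob mxE'.
rewrite /continuation sum_states /EV.
(* At probability 0 the two updates follow different conventions, but the weight 0 hides this. *)
congr (_ + _); rewrite /public_update /private_belief prE mxE' mulrC;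
  by case: eqP => [->|//]; rewrite !mul0r.
Qed.

Lemma continuation_case V pi u : 0 <= \det B -> belief pi -> 0 <= u ->
  continuation V pi u =
  if uL alpha B pi < u <= uH alpha B pi then EV B V pi else V pi.
Proof.
move=> hdet bpi u0; have LH := uL_le_uH hdet bpi.
have hs y := sensor_actionE y bpi u0.
have [uuL|uLu] /= := leP u (uL alpha B pi).
  apply: (@continuation_pooling V pi u two) => // y; rewrite hs.
  case: (state_eqP y) => ->; first by rewrite uuL.
  by rewrite (le_trans uuL LH).
have [uuH|uHu] /= := leP u (uH alpha B pi).
  apply: continuation_separating => y; rewrite hs.
  case: (state_eqP y) => ->; first by rewrite leNgt uLu.
  by rewrite uuH.
apply: (@continuation_pooling V pi u one) => // y; rewrite hs.
by case: (state_eqP y) => ->; rewrite leNgt ?uLu ?uHu.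
Qed.

(** * Rewards, sign of the value and optimal prices *)

Lemma EV_ge V L pi : (forall pi', belief pi' -> L <= V pi') ->
  belief pi -> L <= EV B V pi.
Proof.
move=> hL bpi; rewrite /EV -[L]mul1r -(obs_prob_sum bpi) mulrDl.
by apply: lerD; rewrite ler_wpM2l ?obs_prob_ge0 //; apply: hL; apply: belief_private.
Qed.

Lemma reward_selfE beta pi u : 0 <= \det B -> belief pi ->
  reward_self alpha beta B pi u =
  if u <= uL alpha B pi then u - beta
  else if uL alpha B pi < u <= uH alpha B pi
  then (u - beta) * obs_prob B pi two else 0.
Proof.
move=> hdet bpi; have LH := uL_le_uH hdet bpi.
have -> : reward_self alpha beta B pi u =
    (u - beta) * ((u <= uL alpha B pi)%R%:R * obs_prob B pi one +
                  (u <= uH alpha B pi)%R%:R * obs_prob B pi two).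
  rewrite /reward_self !sum_states !obs_probE /uL /uH /threshold; ring.
have [uuL|uLu] /= := leP u (uL alpha B pi).
  by rewrite (le_trans uuL LH) !mul1r obs_prob_sum // mulr1.
by case: leP => _; rewrite ?mul0r ?mul1r add0r ?mulr0.
Qed.

Lemma value_function_ge0 rho r V pi : 0 <= \det B -> 0 <= rho < 1 ->
  (forall pi', belief pi' -> 0 <= r pi' 1) ->
  value_function alpha rho B r V -> belief pi -> 0 <= V pi.
Proof.
move=> hdet /andP[rho0 rho1] hr [[M hM] hV] bpi.
pose S := V @` [set pi' | belief pi'].
have S0 : S !=set0 by exists (V pi), pi.
have hinf : has_inf S.
  split => //; exists (- M) => _ [pi' bpi' <-].
  by have := hM _ bpi'; rewrite ler_norml => /andP[].
have hL pi' : belief pi' -> inf S <= V pi'.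
  by move=> bpi'; apply: ge_inf; [case: hinf | exists pi'].
(* The infimum runs over all beliefs because the continuation moves the belief. With [rho < 1] this
   inequality forces [inf S] to be nonnegative. *)
have step : rho * inf S <= inf S.
  apply: lb_le_inf => // _ [pi' bpi' <-].
  have /(_ (Qfun alpha rho B r V pi' 1)) := (hV _ bpi').2.
  have H : rho * inf S <= Qfun alpha rho B r V pi' 1.
    rewrite -[leLHS]add0r lerD ?hr // ler_wpM2l //.
    rewrite -/(continuation V pi' 1) continuation_case //.
    by case: ifP => _; [apply: EV_ge|apply: hL].
  move=> h; apply: (le_trans H); apply: h; exists 1 => //=.
  by rewrite in_itv /= ler01 lexx.
by apply: le_trans (hL _ bpi); nra.
Qed.

(** Common to both rewards. Outside [P], either of rho v and 0 equals [v] only when [v] is 0, so the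
    maximisers agree; 0 stays below the maximum since [0 <= v]. *)
Lemma max_price_simplify rho (q qs : R -> R) (P : pred R) (v : R) :
  rho < 1 -> 0 <= v -> is_max_price q v ->
  (forall u, 0 <= u <= 1 -> P u -> q u = qs u) ->
  (forall u, 0 <= u <= 1 -> ~~ P u -> q u = rho * v) ->
  (forall u, ~~ P u -> qs u = 0) ->
  (forall u, 0 <= u <= 1 -> (q u = v <-> qs u = v)) /\ is_max_price qs v.
Proof.
move=> rho1 v0 [[u0 hu0 qu0] ubv] hP hN hs0.
have E u : 0 <= u <= 1 -> (q u = v <-> qs u = v).
  move=> hu; have [Pu|nPu] := boolP (P u); first by rewrite hP.
  by rewrite hN // hs0 //; split=> [e|<-]; [nra|rewrite mulr0].
have in01 u : `[0, 1]%classic u = (0 <= u <= 1) by rewrite /= in_itv.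
split=> //; split.
  by exists u0 => //; apply/E => //; rewrite -in01.
move=> _ [u hu <-]; have hu' : 0 <= u <= 1 by rewrite -in01.
have [Pu|nPu] := boolP (P u); last by rewrite hs0.
by rewrite -hP //; apply: ubv; exists u.
Qed.

End SocialLearning.

Theorem theorem1 (R : realType) (alpha beta rho : R) (B : 'M[R]_2)
    (halpha : 0 < alpha <= 1) (hbeta : 0 < beta < 1) (hrho : 0 <= rho < 1)
    (hB : row_stochastic B) (hTP2 : 0 <= \det B) :
  (* (1) self-interested reward *)
  (forall V : 'cV[R]_2 -> R,
     value_function alpha rho B (reward_self alpha beta B) V ->
   forall pi : 'cV[R]_2, belief pi ->
     let Q := Qfun alpha rho B (reward_self alpha beta B) V pi in
     let Qs := Qsimp_self alpha beta rho B V pi in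
     [/\ (* the simplified form on the two regions with nontrivial value *)
         forall u : R, 0 <= u <= 1 ->
           (u <= uL alpha B pi) || (uL alpha B pi < u <= uH alpha B pi) ->
           Q u = Qs u,
         (* on the remaining region Q = rho V, which Qs replaces by 0 *)
         forall u : R, 0 <= u <= 1 ->
           ~~ ((u <= uL alpha B pi) || (uL alpha B pi < u <= uH alpha B pi)) ->
           Q u = rho * V pi,
         (* without changing the optimal prices, nor Q at them *)
         forall u : R, 0 <= u <= 1 ->
           (Q u = V pi <-> Qs u = V pi),
         is_max_price Qs (V pi)
       & 0 <= V pi])
  /\
  (* (2) altruistic reward *)
  (forall V : 'cV[R]_2 -> R,
     value_function alpha rho B (reward_altr alpha beta B) V ->
   forall pi : 'cV[R]_2, belief pi ->
     let Q := Qfun alpha rho B (reward_altr alpha beta B) V pi in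
     let Qs := Qsimp_altr alpha beta rho B V pi in
     [/\ forall u : R, 0 <= u <= 1 ->
           uL alpha B pi < u <= uH alpha B pi -> Q u = Qs u,
         forall u : R, 0 <= u <= 1 ->
           ~~ (uL alpha B pi < u <= uH alpha B pi) -> Q u = rho * V pi,
         forall u : R, 0 <= u <= 1 ->
           (Q u = V pi <-> Qs u = V pi),
         is_max_price Qs (V pi)
       & 0 <= V pi]).
Proof.
case/andP: (hrho) => rho0 rho1; case/andP: (hbeta) => beta0 beta1.
have fold r V pi u : 0 <= u <= 1 -> belief pi -> Qfun alpha rho B r V pi u =
    r pi u + rho * if uL alpha B pi < u <= uH alpha B pi then EV B V pi else V pi.
  by move=> /andP[u0 _] bpi; rewrite -continuation_case.
split=> V hV pi bpi Q Qs.
- have V0 : 0 <= V pi.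
    (* At price 1 the margin 1 - beta is positive, so every branch of the reward is nonnegative. *)
    apply: value_function_ge0 hV bpi => // pi' bpi'; rewrite reward_selfE //.
    case: ifP => _; first by rewrite subr_ge0 ltW.
    case: ifP => _ //; rewrite mulr_ge0 ?obs_prob_ge0 //; lra.
  pose P u := (u <= uL alpha B pi) || (uL alpha B pi < u <= uH alpha B pi).
  have hP u : 0 <= u <= 1 -> P u -> Q u = Qs u.
    move=> hu; rewrite /P /Q fold // reward_selfE // /Qs /Qsimp_self.
    by case: leP => //= _ ->.
  have hN u : 0 <= u <= 1 -> ~~ P u -> Q u = rho * V pi.
    move=> hu; rewrite /P negb_or => /andP[nL nLH]; rewrite /Q fold // reward_selfE //.
    by rewrite (negPf nL) (negPf nLH) add0r.
  have [] := @max_price_simplify R rho Q Qs P (V pi) rho1 V0 (hV.2 _ bpi) hP hN.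
    by move=> u; rewrite negb_or /Qs /Qsimp_self => /andP[/negPf-> /negPf->].
  by move=> hE hM; split.
- have V0 : 0 <= V pi.
    apply: value_function_ge0 hV bpi => // pi' bpi'.
    by rewrite mulr_ge0 ?ler0n //; lra.
  pose P u := uL alpha B pi < u <= uH alpha B pi.
  have hP u : 0 <= u <= 1 -> P u -> Q u = Qs u.
    move=> hu Pu; rewrite /Q fold // /reward_altr /Qs /Qsimp_altr.
    by rewrite (Pu : _ < u <= _) mulr1.
  have hN u : 0 <= u <= 1 -> ~~ P u -> Q u = rho * V pi.
    move=> hu /negPf nP; rewrite /Q fold // /reward_altr.
    by rewrite (nP : (_ < u <= _) = false) mulr0 add0r.
  have [] := @max_price_simplify R rho Q Qs P (V pi) rho1 V0 (hV.2 _ bpi) hP hN.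
    by move=> u /negPf nP; rewrite /Qs /Qsimp_altr (nP : (_ < u <= _) = false).
  by move=> hE hM; split.
Qed.
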